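(* Let $P$ be a finite set (zero-dimensional polytope) consisting of $m \ge 1$ points, and let $Q$ be a one-dimensional polytope that is partitioned into $f_0$ points (0-cells) and $f_1$ bounded relatively open line segments (1-cells), so that $\chi(Q)=f_0-f_1$. Stratify the set $P^Q$ of polyhedral maps $Q \to P$ into cells as described in the context. For each $k\ge 0$ the number $c_k$ of $k$-dimensional cells is finite, and the generating series $\sum_{k\ge 0} c_k t^k$ is the power series expansion at $t=0$ of the rational function $$ m^{f_0}\left(\frac{m}{1-(m^2-1)t}\right)^{f_1}.$$ The value of this rational function at $t=-1$ is $m^{f_0-f_1} = \chi(P)^{\chi(Q)}$.
   Context: A polyhedron is a subset of some $\mathbb{R}^n$ defined by a finite Boolean combination of linear (affine) equations and inequalities; a polytope is a bounded polyhedron. A map between polyhedra is polyhedral if its graph is a polyhedron. The Euler measure $\chi$ of a polytope is $\sum_i (-1)^i f_i$, where $f_i$ is the number of $i$-cells in any partition of the polytope into finitely many relatively open cells; it does not depend on the partition. Cell stratification of $P^Q$: parametrize each 1-cell of $Q$ affinely by $(0,1)$. A polyhedral map from $(0,1)$ to the finite set $P$ has finitely many discontinuities $x_1<\dots<x_k$ in $(0,1)$. With $x_0=0$ and $x_{k+1}=1$, it is uniquely specified by these points together with values $a_0,b_1,a_1,\dots,b_k,a_k\in P$ such that $f(x)=a_i$ for $x_i<x<x_{i+1}$ and $f(x_i)=b_i$, where for every $1\le i\le k$ the values $a_{i-1},b_i,a_i$ are not all equal. For each admissible sequence $(a_0,b_1,a_1,\dots,b_k,a_k)$, the maps with that sequence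 form a $k$-dimensional cell, identified with the open simplex $\{(x_1,\dots,x_k): 0<x_1<\dots<x_k<1\}$. A polyhedral map from a single point to $P$ is a choice of a point of $P$, so the set of such maps consists of $m$ 0-cells. A polyhedral map $Q\to P$ is a choice of a polyhedral map to $P$ on each of the $f_0$ 0-cells and each of the $f_1$ 1-cells of $Q$; the cells of $P^Q$ are the products of the cells chosen for the individual cells of $Q$, with dimensions adding. *)

(* Defs.v *)
From mathcomp Require Export all_boot all_order all_algebra finmap.
From mathcomp Require Export all_classical all_reals all_analysis.
Export Order.TTheory GRing.Theory Num.Theory.
Export numFieldNormedType.Exports.

#[export] Set Implicit Arguments.
#[export] Unset Strict Implicit.
#[export] Unset Printing Implicit Defensive.

Local Open Scope classical_set_scope.
Local Open Scope ring_scope.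

(* R^n is 'rV[R]_n; an affine condition on x compares (x *m a) 0 0, the dot
   product of x with the column a, to a constant. *)
Inductive polyhedron (R : realType) (n : nat) : set 'rV[R]_n -> Prop :=
| polyhedron_eq (a : 'cV[R]_n) (c : R) : polyhedron [set x | (x *m a) 0 0 = c]
| polyhedron_le (a : 'cV[R]_n) (c : R) : polyhedron [set x | (x *m a) 0 0 <= c]
| polyhedronC A : polyhedron A -> polyhedron (~` A)
| polyhedronI A B : polyhedron A -> polyhedron B -> polyhedron (A `&` B)
| polyhedronU A B : polyhedron A -> polyhedron B -> polyhedron (A `|` B).

Definition polytope (R : realType) (n : nat) (A : set 'rV[R]_n) : Prop :=
  polyhedron A /\ bounded_set A.

(* Maps A -> B are functions between the subtypes carried by the sets A and B,
   so that two maps are equal exactly when they agree on A. *)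
Definition graph (R : realType) (n p : nat)
    (A : set 'rV[R]_n) (B : set 'rV[R]_p) (f : A -> B) : set 'rV[R]_(n + p) :=
  [set row_mx (\val x) (\val (f x)) | x in [set: A]].

Definition polyhedral_map (R : realType) (n p : nat)
    (A : set 'rV[R]_n) (B : set 'rV[R]_p) (f : A -> B) : Prop :=
  polyhedron (graph f).

(* A relatively open bounded cell: an affine subspace x *m E = b cut by finitely
   many strict inequalities. Being nonempty and open in {x | x *m E = b}, it
   spans this subspace, whose dimension is n - \rank E. *)
Definition open_cell (R : realType) (n k : nat) (C : set 'rV[R]_n) : Prop :=
  [/\ C !=set0, bounded_set C &
    exists (r s : nat) (E : 'M[R]_(n, r)) (b : 'rV[R]_r)
           (G : 'M[R]_(n, s)) (h : 'rV[R]_s),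
      k = (n - \rank E)%N /\
      C = [set x | x *m E = b /\ forall j, (x *m G) 0 j < h 0 j]].

Definition polyhedral_dim (R : realType) (n : nat) (A : set 'rV[R]_n) (k : nat)
    : Prop :=
  (exists2 C, open_cell k C & C `<=` A) /\
  (forall l C, open_cell l C -> C `<=` A -> (l <= k)%N).

Definition is_euler_sum (R : realType) (n : nat) (A : set 'rV[R]_n) (c : int)
    : Prop :=
  exists (N : nat) (C : 'I_N -> set 'rV[R]_n) (k : 'I_N -> nat),
    [/\ forall i, open_cell (k i) (C i),
        partition [set: 'I_N] C A &
        c = \sum_(i < n.+1) (-1) ^+ i * #|[set j | k j == i]%SET|%:Z].

(* The alternating sum of an arbitrary partition into cells; nothing is assumed
   about its independence of the partition. *)
Definition euler_measure (R : realType) (n : nat) (A : set 'rV[R]_n) : int :=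
  xget 0 [set c | is_euler_sum A c].

Definition seg_param (R : realType) (d : nat) (u v : 'rV[R]_d) (s : R)
    : 'rV[R]_d := u + s *: (v - u).

Definition open_segment (R : realType) (d : nat) (u v : 'rV[R]_d)
    : set 'rV[R]_d := [set seg_param u v s | s in `]0, 1[].

(* Points p i and open segments from u j to v j, forming a partition of Q. *)
Definition is_cell_decomposition (R : realType) (d f0 f1 : nat)
    (Q : set 'rV[R]_d) (p : 'I_f0 -> 'rV[R]_d) (u v : 'I_f1 -> 'rV[R]_d)
    : Prop :=
  (forall j, u j != v j) /\
  partition [set: 'I_f0 + 'I_f1]
    (fun c => match c with
              | inl i => [set p i]
              | inr j => open_segment (u j) (v j)
              end) Q.

(* The sequence (a_0, b_1, a_1, ..., b_k, a_k) is stored as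
   (a_0, [:: (b_1, a_1); ...; (b_k, a_k)]). *)
Definition pattern (T : Type) : Type := (T * seq (T * T))%type.

Definition jumps (T : Type) (w : pattern T) : nat := size w.2.

Definition pat_a (T : Type) (w : pattern T) (i : nat) : T :=
  nth w.1 (w.1 :: unzip2 w.2) i.

(* b_i for 1 <= i <= k *)
Definition pat_b (T : Type) (w : pattern T) (i : nat) : T :=
  nth w.1 (unzip1 w.2) i.-1.

Definition admissible (T : Type) (w : pattern T) : Prop :=
  forall i, (1 <= i <= jumps w)%N ->
    ~ (pat_a w i.-1 = pat_b w i /\ pat_b w i = pat_a w i).

(* The points 0 = x_0, x_1, ..., x_k, x_{k+1} = 1. *)
Definition breaks (R : realType) (x : seq R) : seq R := 0 :: rcons x 1.

Definition open_simplex (R : realType) (k : nat) : set (seq R) :=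
  [set x | size x = k /\ sorted <%R (breaks x)].

(* y is the value at s in (0,1) of the step function with breakpoints x and
   values w. *)
Definition step_value (R : realType) (T : Type) (w : pattern T) (x : seq R)
    (s : R) (y : T) : Prop :=
  (forall i, (i <= jumps w)%N ->
     (breaks x)`_i < s < (breaks x)`_i.+1 -> y = pat_a w i) /\
  (forall i, (1 <= i <= jumps w)%N -> s = (breaks x)`_i -> y = pat_b w i).

(* The product of the 0-cells a i of P^{p i} and of the cells of P^{(0,1)} with
   patterns w j, transported along the parametrizations of the 1-cells of Q. *)
Definition map_cell (R : realType) (n d f0 f1 : nat)
    (P : set 'rV[R]_n) (Q : set 'rV[R]_d)
    (p : 'I_f0 -> 'rV[R]_d) (u v : 'I_f1 -> 'rV[R]_d)
    (a : 'I_f0 -> P) (w : 'I_f1 -> pattern P) : set (Q -> P) :=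
  [set f | [/\ polyhedral_map f,
    forall i (q : Q), \val q = p i -> f q = a i &
    forall j, exists2 x : seq R, open_simplex (jumps (w j)) x &
      forall (s : R) (q : Q), 0 < s < 1 -> \val q = seg_param (u j) (v j) s ->
        step_value (w j) x s (f q)]].

Definition k_cells (R : realType) (n d f0 f1 : nat)
    (P : set 'rV[R]_n) (Q : set 'rV[R]_d)
    (p : 'I_f0 -> 'rV[R]_d) (u v : 'I_f1 -> 'rV[R]_d) (k : nat)
    : set (set (Q -> P)) :=
  [set C | exists (a : 'I_f0 -> P) (w : 'I_f1 -> pattern P),
    [/\ forall j, admissible (w j),
        (\sum_(j < f1) jumps (w j))%N = k &
        C = map_cell p u v a w]].
Arguments k_cells {R n d f0 f1} P Q p u v k.

Definition num_cells (R : realType) (n d f0 f1 : nat)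
    (P : set 'rV[R]_n) (Q : set 'rV[R]_d)
    (p : 'I_f0 -> 'rV[R]_d) (u v : 'I_f1 -> 'rV[R]_d) (k : nat) : nat :=
  #|` fset_set (k_cells P Q p u v k)|%fset.
Arguments num_cells {R n d f0 f1} P Q p u v k.

Definition cell_gf (R : realType) (m f0 f1 : nat) (t : R) : R :=
  m%:R ^+ f0 * (m%:R / (1 - (m%:R ^+ 2 - 1) * t)) ^+ f1.

(* Main.v *)
Require Import Defs.
From mathcomp Require Import ring lra.

(** A cell of dimension at most one is a point or an open
    segment ([open_cell_piece]).  A linear form [l] that is not constant on any
    of finitely many given segments maps each piece injectively to a point or
    to an open interval of the line.  Hence the number of pieces met by a fibre
    [l = t] is the number of points of the set in that fibre, and does not
    depend on the partition.  For a finite set [T] of reals containing all end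
    points and a small [e > 0], the functional sending [g] to the sum over [T]
    of [g t - g (t + e)] is 1 on the indicator of a point and -1 on the
    indicator of an open interval ([shadow_shift]).  Applied to the fibre
    count it yields the alternating sum of the partition, so this sum depends
    on the set only ([piece_count_unique], [euler_measure_cells]).

    A cell of the space of maps is given by a point of [P] for each 0-cell and an
    admissible pattern for each 1-cell of [Q].  Different data give different
    cells: every cell contains a map, because a step function has a polyhedral
    graph ([map_cell_nonempty]), and a map determines the data of its cell,
    because in an admissible pattern the first break point is the first point
    near which the step function is not constant
    ([steps_unique], [map_cell_disjoint]).

    Let [N f k] be the number of families of [f] admissible patterns
    with [k] jumps in all.  The first pattern of a family either has no jump
    ([m] choices for its value), or arises from a pattern starting with [c] by
    prepending a pair [(a, b)] other than [(c, c)], so that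
    [N f.+1 k.+1 = m * N f k.+1 + (m ^ 2 - 1) * N f.+1 k].
    With [q = (m ^ 2 - 1) * t], the partial sums [S f n] of the series of [N f]
    thus satisfy [S f.+1 n.+1 = q * S f.+1 n + m * S f n.+1], and for [`|q| < 1]
    the limit of [S f.+1] is [m / (1 - q)] times that of [S f]
    ([affine_recurrence_cvg], [families_gf]). *)

Local Open Scope classical_set_scope.
Local Open Scope ring_scope.

(** * Alternating sums of points and open intervals of the line *)

(** Indicator of the image of a point ([b] false) or of an open segment
    ([b] true) under a linear form. *)
Definition shadow (R : realType) (b : bool) (al be t : R) : bool :=
  if b then al < t < be else t == al.

(** For [t] in [T], the point [t + e] lies in the interval from [al] to [be] if
    and only if [al <= t < be], so the summand of an interval vanishes except at
    [t = al].  In the case of a point, no [t + e] equals [al]. *)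
Lemma shadow_shift (R : realType) (b : bool) (al be e : R) (T : seq R) :
  uniq T -> al \in T -> be \in T -> (b -> al < be) -> 0 < e ->
  {in T &, forall s t, s < t -> s + e < t} ->
  \sum_(t <- T) ((shadow b al be t)%:Z - (shadow b al be (t + e))%:Z)
    = (-1) ^+ b.
Proof.
move=> uT alT beT lab e0 gap.
have count1 x : x \in T -> \sum_(t <- T) (t == x)%:Z = 1.
  move=> xT; rewrite (bigD1_seq x)//= eqxx big1_seq ?addr0// => t /andP[tx _].
  by rewrite (negbTE tx).
case: b lab => /= [/(_ isT) lab|_]; last first.
  rewrite sumrB count1// big1_seq ?subr0// => t /andP[_ tT].
  case: eqP => // te.
  have t_al : t < al by rewrite -te ltrDl.
  by have := gap _ _ tT alT t_al; rewrite te ltxx.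
rewrite -(count1 _ alT) -sumrN; apply: eq_big_seq => t tT.
have -> : (t + e < be) = (t < be).
  apply/idP/idP => [|tb]; last exact: gap.
  by apply: le_lt_trans; rewrite lerDl ltW.
have -> : (al < t + e) = (al <= t).
  apply/idP/idP => [|tb]; last by rewrite (le_lt_trans tb)// ltrDl.
  by apply: contraTT; rewrite -ltNge -leNgt => ta; rewrite ltW// gap.
by rewrite le_eqVlt eq_sym; case: eqP => [->|]/=; rewrite ?ltxx ?lab//= subrr.
Qed.

Lemma uniform_gap (R : realType) (T : seq R) :
  exists2 e : R, 0 < e & {in T &, forall s t, s < t -> s + e < t}.
Proof.
pose D := [seq t - s | s <- T, t <- T].
(* The least positive difference of two members of [T], if there is any. *)
pose e := \big[Num.min/1]_(x <- D | 0 < x) x.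
have e0 : 0 < e.
  by rewrite /e; elim/big_ind : _ => // x y x0 y0; rewrite lt_min x0.
exists (e / 2) => [|s t sT tT st]; first by rewrite divr_gt0.
rewrite -ltrBrDl (@lt_le_trans _ _ e)//; first by rewrite gtr_pMr// invf_lt1// ltr1n.
apply: (@ge_bigmin_seq _ _ _ _ _ _ _ id); first by apply/allpairsP; exists (s, t).
by rewrite subr_gt0.
Qed.

(** The functional of [shadow_shift] is additive, and evaluates both sums of
    indicators to the corresponding alternating sums. *)
Lemma shadow_sum_unique (R : realType) (I J : finType)
    (b : I -> bool) (al be : I -> R) (b' : J -> bool) (al' be' : J -> R) :
  (forall i, b i -> al i < be i) -> (forall j, b' j -> al' j < be' j) ->
  (forall t, \sum_i (shadow (b i) (al i) (be i) t)%:Z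
             = \sum_j (shadow (b' j) (al' j) (be' j) t)%:Z) ->
  \sum_i (-1) ^+ b i = \sum_j (-1) ^+ b' j :> int.
Proof.
move=> lab lab' eqN.
pose T := undup ([seq al i | i : I] ++ [seq be i | i : I] ++
                 [seq al' j | j : J] ++ [seq be' j | j : J]).
have [e e0 gap] := uniform_gap T.
have alT i : al i \in T by rewrite mem_undup !mem_cat map_f ?mem_enum.
have beT i : be i \in T by rewrite mem_undup !mem_cat map_f ?mem_enum ?orbT.
have alT' i : al' i \in T.
  by rewrite mem_undup !mem_cat (map_f al') ?mem_enum ?orbT.
have beT' i : be' i \in T.
  by rewrite mem_undup !mem_cat (map_f be') ?mem_enum ?orbT.
have uT : uniq T by exact: undup_uniq.
transitivity (\sum_(t <- T) (\sum_i (shadow (b i) (al i) (be i) t)%:Z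
   - \sum_i (shadow (b i) (al i) (be i) (t + e))%:Z)).
  under [RHS]eq_bigr => t _ do rewrite -sumrB.
  rewrite exchange_big; apply: eq_bigr => i _.
  by rewrite shadow_shift//; exact: lab.
under eq_bigr => t _ do rewrite !eqN -sumrB.
rewrite exchange_big; apply: eq_bigr => i _.
by rewrite shadow_shift//; exact: lab'.
Qed.

(** * Cells of dimension at most one *)

Lemma addrKAl (V : zmodType) (x y z : V) : (x + y) - (x + z) = y - z.
Proof. by rewrite [x + y]addrC addrKA. Qed.

(** [K] is the direction space of the cell, the kernel of the equations.  The
    strict inequalities make the cell open in its affine span, and convex. *)
Lemma open_cell_perturb (R : realType) (n k : nat) (C : set 'rV[R]_n) :
  open_cell k C ->
  exists K : 'M[R]_n, [/\ \rank K = k,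
    forall x y, C x -> C y -> (y - x <= K)%MS,
    forall x w, C x -> (w <= K)%MS ->
      exists2 e : R, 0 < e & forall s, `|s| < e -> C (x + s *: w) &
    forall x y s, C x -> C y -> 0 <= s <= 1 -> C (x + s *: (y - x))].
Proof.
move=> [_ _ [r [s0 [E [b [G [h [-> ->]]]]]]]].
exists (kermx E); split => [||x w [xE xG]|x y s [xE xG] [yE yG] /andP[s0' s1]].
- exact: mxrank_ker.
- by move=> x y [xE _] [yE _]; apply/sub_kermxP; rewrite mulmxBl xE yE subrr.
- move=> /sub_kermxP wE.
  pose e := \big[Num.min/1]_j ((h 0 j - (x *m G) 0 j) / (`|(w *m G) 0 j| + 1)).
  have c0 j : 0 < `|(w *m G) 0 j| + 1 by rewrite ltr_pwDr.
  exists e => [|s se].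
    rewrite /e; elim/big_ind : _ => // [y z y0 z0|j _]; first by rewrite lt_min y0.
    by rewrite divr_gt0// subr_gt0.
  split=> [|j]; first by rewrite mulmxDl -scalemxAl wE scaler0 addr0.
  suff : s * (w *m G) 0 j < h 0 j - (x *m G) 0 j.
    rewrite mulmxDl -scalemxAl; move: (x *m G) (w *m G) => X W.
    by rewrite ltrBrDl !mxE.
  have := c0 j; set c := (w *m G) 0 j => cj.
  apply: (@le_lt_trans _ _ (`|s| * (`|c| + 1))).
    by rewrite (le_trans (ler_norm _))// normrM ler_wpM2l ?lerDl.
  rewrite -ltr_pdivlMr//; apply: (lt_le_trans se).
  pose F i := (h 0 i - (x *m G) 0 i) / (`|(w *m G) 0 i| + 1).
  by apply: (@ge_bigmin_seq _ _ _ _ _ _ _ F); rewrite ?mem_index_enum.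
- split=> [|j].
    by rewrite mulmxDl -scalemxAl mulmxBl xE yE subrr scaler0 addr0.
  rewrite mulmxDl -scalemxAl mulmxBl.
  have := xG j; have := yG j.
  move: (x *m G) (y *m G) => X Y; rewrite !mxE => Yh Xh.
  have -> : X 0 j + s * (Y 0 j - X 0 j) = (1 - s) * X 0 j + s * Y 0 j.
    by rewrite mulrBl mulrBr mul1r addrCA addrC addrAC.
  have [->|sn0] := eqVneq s 0; first by rewrite subr0 mul1r mul0r addr0.
  have sp : 0 < s by rewrite lt_def sn0.
  have -> : h 0 j = (1 - s) * h 0 j + s * h 0 j by rewrite -mulrDl subrK mul1r.
  by rewrite ler_ltD// ?ltr_pM2l// ler_wpM2l ?subr_ge0// ltW.
Qed.

Definition piece (R : realType) (d : nat) (b : bool) (u v : 'rV[R]_d)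
  : set 'rV[R]_d := if b then open_segment u v else [set u].

Lemma bounded_slice_le (R : realType) (n : nat) (C : set 'rV[R]_n)
    (x w : 'rV[R]_n) :
  bounded_set C -> w != 0 -> exists M : R, forall s, C (x + s *: w) -> `|s| <= M.
Proof.
move=> [M [_ HM]] w0; exists ((M + 1 + `|x|) / `|w|) => s Cs.
rewrite ler_pdivlMr ?normr_gt0// -normrZ -[s *: w](addrK x) [_ + x]addrC.
by rewrite (le_trans (ler_normB _ _))// lerD2r HM// ltrDl.
Qed.

(** In dimension one the cell is the set of all [x + s *: w] with [s] in a
    bounded, open and convex set of reals [S], hence in an open interval with
    end points [inf S] and [sup S]. *)
Lemma open_cell_piece (R : realType) (n k : nat) (C : set 'rV[R]_n) :
  open_cell k C -> (k <= 1)%N ->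
  exists u v, ((k == 1)%N -> u != v) /\ C = piece (k == 1)%N u v.
Proof.
move=> Ck k1.
have [[x Cx] bC _] := Ck.
have [K [rK CK Kopen Kconv]] := open_cell_perturb Ck.
case: k k1 {Ck} rK => [_ /eqP|[_ rK|//]].
  rewrite mxrank_eq0 => /eqP K0; exists x, x; split => //=.
  apply/seteqP; split => [y Cy|_ -> //].
  by have := CK _ _ Cx Cy; rewrite K0 submx0 subr_eq0 => /eqP.
pose w := nz_row K.
have w0 : w != 0 by rewrite nz_row_eq0 -mxrank_eq0 rK.
have wK : (w <= K)%MS := nz_row_sub K.
have Kw : (K <= w)%MS by rewrite -(geq_leqif (mxrank_leqif_sup wK)) rK rank_rV w0.
pose S := [set s | C (x + s *: w)].
have CE y : C y -> exists2 s, S s & y = x + s *: w.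
  move=> Cy; have /sub_rVP[s sE] := submx_trans (CK _ _ Cx Cy) Kw.
  have yE : y = x + s *: w by rewrite -sE addrC subrK.
  by exists s; rewrite // /S/= -yE.
have S0 : S 0 by rewrite /S/= scale0r addr0.
have nS : S !=set0 by exists 0.
have Sopen s : S s -> exists2 e : R, 0 < e & forall t, `|t| < e -> S (s + t).
  move=> Ss; have [e e0 eC] := Kopen _ _ Ss wK; exists e => // t te.
  by rewrite /S/= scalerDl addrA; exact: eC.
have Sconv s1 s2 s : S s1 -> S s2 -> s1 < s -> s < s2 -> S s.
  move=> S1 S2 s1s ss2; have s12 := lt_trans s1s ss2.
  have := Kconv _ _ ((s - s1) / (s2 - s1)) S1 S2.
  rewrite addrKAl -scalerBl scalerA divfK ?subr_eq0 ?gt_eqF// -addrA -scalerDl.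
  rewrite [s1 + _]addrC subrK; apply; apply/andP; split.
    by rewrite divr_ge0// subr_ge0 ltW.
  by rewrite ler_pdivrMr ?subr_gt0// mul1r lerD2r ltW.
have [M SM] := bounded_slice_le x bC w0.
have uS : has_ubound S.
  by exists M => s /SM; apply: le_trans; exact: ler_norm.
have lS : has_lbound S.
  by exists (- M) => s /SM; rewrite ler_norml => /andP[].
have SE s : S s <-> inf S < s < sup S.
  split=> [Ss|/andP[/inf_lt -/(_ nS)[s1 S1 s1s] /sup_gt -/(_ nS)[s2 S2 ss2]]].
    have [e e0 eS] := Sopen _ Ss.
    have e2 : `|e / 2| < e by rewrite gtr0_norm ?divr_gt0// gtr_pMr// invf_lt1// ltr1n.
    apply/andP; split.
      apply: (@le_lt_trans _ _ (s - e / 2)); last by rewrite gtrDl oppr_lt0 divr_gt0.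
      by apply: ge_inf => //; apply: eS; rewrite normrN.
    apply: (@lt_le_trans _ _ (s + e / 2)); first by rewrite ltrDl divr_gt0.
    by apply: ub_le_sup => //; apply: eS.
  exact: (Sconv s1 s2).
have ab : inf S < sup S by have /andP[] := (SE 0).1 S0; exact: lt_trans.
have segE t : seg_param (x + inf S *: w) (x + sup S *: w) t
              = x + (inf S + t * (sup S - inf S)) *: w.
  by rewrite /seg_param addrKAl -scalerBl scalerA -addrA -scalerDl.
exists (x + inf S *: w), (x + sup S *: w); split => /=.
  move=> _; rewrite -subr_eq0 addrKAl -scalerBl scaler_eq0 negb_or w0 andbT.
  by rewrite subr_eq0 lt_eqF.
apply/seteqP; split => [y /CE[s /SE/andP[sa sb] ->]|_ [t /= t01 <-]].
  exists ((s - inf S) / (sup S - inf S)).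
    rewrite /= in_itv/= divr_gt0 ?subr_gt0//=.
    by rewrite ltr_pdivrMr ?subr_gt0// mul1r ltrD2r.
  by rewrite segE divfK ?subr_eq0 ?gt_eqF// [inf S + _]addrC subrK.
rewrite segE; apply/SE; move: t01; rewrite in_itv/= => /andP[t0 t1].
rewrite ltrDl mulr_gt0 ?subr_gt0//= -ltrBrDl gtr_pMl ?subr_gt0//.
Qed.

(** Points of the cell tending to [x] along a direction of its affine span.  In
    a finite set all cells thus have dimension zero. *)
Lemma open_cell_infinite (R : realType) (n k : nat) (C : set 'rV[R]_n) :
  open_cell k C -> (0 < k)%N -> infinite_set C.
Proof.
move=> Ck k0 fC.
have [[x Cx] bC _] := Ck.
have [K [rK _ Kopen _]] := open_cell_perturb Ck.
have w0 : nz_row K != 0 by rewrite nz_row_eq0 -mxrank_eq0 rK -lt0n.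
have [e e0 eC] := Kopen _ _ Cx (nz_row_sub K).
apply: infinite_nat.
pose f (i : nat) := x + (e / i.+2%:R) *: nz_row K.
rewrite (_ : setT = f @^-1` C).
  apply: finite_preimage => // i j _ _ /addrI /eqP.
  rewrite -subr_eq0 -scalerBl scaler_eq0 (negbTE w0) orbF subr_eq0 => /eqP.
  by move=> /(mulfI (lt0r_neq0 e0)) /invr_inj /eqP; rewrite eqr_nat => /eqP [].
apply/esym/seteqP; split => // i _; apply: eC.
by rewrite ger0_norm ?divr_ge0 ?ltW// gtr_pMr// invf_lt1// ?ltr1n//.
Qed.

(** A segment of direction [w] is the part of the line [x *m cokermx w =
    u *m cokermx w] where the scalar product with [w] lies strictly between its
    values at the end points. *)
Lemma piece_open_cell (R : realType) (n : nat) (b : bool) (u v : 'rV[R]_n) :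
  (b -> u != v) -> open_cell b (piece b u v).
Proof.
case: b => [/(_ isT) uv|_]; last first.
  split; first by exists u.
    by exists `|u|; split => [|M /ltW HM _ ->]; rewrite ?num_real.
  exists n, 0, 1%:M, u, 0, 0; split; first by rewrite mxrank1 subnn.
  apply/seteqP; split => [_ -> /=|x [/= <- _]]; rewrite mulmx1 //.
  by split => // -[].
have w0 : v - u != 0 by rewrite subr_eq0 eq_sym.
split.
- exists (seg_param u v (2^-1)), (2^-1) => //=.
  by rewrite in_itv/= invr_gt0 invf_lt1 ?ltr0n ?ltr1n.
- exists (`|u| + `|v - u|); split => [|M HM _ [t /= /[!in_itv]/= /andP[t0 t1] <-]].
    by rewrite num_real.
  rewrite (le_trans _ (ltW HM))// (le_trans (ler_normD _ _))// lerD2l normrZ.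
  by rewrite ler_piMl// gtr0_norm// ltW.
have [w wE] : exists w, w = v - u by exists (v - u).
rewrite -wE in w0; pose c := (w *m w^T) 0 0.
(* [c] is the sum of the squares of the entries of [w]. *)
have c0 : 0 < c.
  rewrite /c mxE lt_def sumr_ge0 ?andbT => [|i _]; last by rewrite mxE -expr2 sqr_ge0.
  apply: contra w0 => /eqP /psumr_eq0P z; apply/eqP/rowP => i.
  apply/eqP; rewrite [X in _ == X]mxE -sqrf_eq0 expr2.
  have := z (fun j _ => _) i isT; rewrite !mxE => ->//.
  by move=> j; rewrite mxE -expr2 sqr_ge0.
have E t : ((u + t *: w) *m w^T) 0 0 = (u *m w^T) 0 0 + t * c.
  rewrite mulmxDl -scalemxAl /c; move: (u *m w^T) (w *m w^T) => X Y.
  by rewrite !mxE.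
have E2 : (v *m w^T) 0 0 = (u *m w^T) 0 0 + c.
  by rewrite -[v](subrK u) -wE addrC -[w in u + w]scale1r E mul1r.
exists n, (1 + 1)%N, (cokermx w), (u *m cokermx w), (row_mx (- w^T) w^T),
  (row_mx (- (u *m w^T)) (v *m w^T)).
split.
  rewrite mxrank_coker rank_rV w0 /= subKn//.
  by have := rank_leq_col w; rewrite rank_rV w0.
apply/seteqP; split => [_ [t /= /[!in_itv]/= /andP[t0 t1] <-]|x [/= xE xG]].
  split.
    by rewrite /seg_param -wE mulmxDl -scalemxAl mulmx_coker scaler0 addr0.
  move=> j; rewrite mul_mx_row mulmxN /seg_param -wE.
  case: (split_ordP j) => i ->; rewrite ord1.
    rewrite !row_mxEl mxE [X in _ < X]mxE E ltrN2 ltrDl mulr_gt0//.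
  by rewrite !row_mxEr E E2 ltrD2l gtr_pMl.
have /sub_rVP[t tE] : (x - u <= w)%MS by rewrite submxE mulmxBl xE subrr.
have xE' : x = u + t *: w by rewrite -tE addrC subrK.
exists t; last by rewrite /seg_param -wE.
have := xG (rshift 1 0); have := xG (lshift 1 0).
rewrite xE' mul_mx_row mulmxN !row_mxEl !row_mxEr mxE [X in _ < X -> _]mxE !E E2.
rewrite ltrN2 ltrDl ltrD2l gtr_pMl// pmulr_lgt0// /= in_itv/=.
by move=> -> ->.
Qed.

(** * Independence of the alternating sum from the partition *)

(** The linear form with coefficients [1, x, x ^+ 2, ...] takes at [w i] the
    value at [x] of the polynomial with coefficient vector [w i]; some [x] is a
    root of none of these finitely many nonzero polynomials. *)
Lemma generic_form (R : realType) (d : nat) (K : finType) (w : K -> 'rV[R]_d) :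
  (forall i, w i != 0) ->
  exists l : 'cV[R]_d, forall i, (w i *m l) 0 0 != 0.
Proof.
move=> w0.
pose f : {poly R} := \prod_i rVpoly (w i).
have f0 : f != 0.
  apply/prodf_neq0 => i _; apply: contra (w0 i) => /eqP r0.
  by rewrite -[w i]rVpolyK r0 linear0.
have [x fx] : exists x : R, ~~ root f x.
  apply: contrapT => all_root.
  (* As many roots as the size of [f] are too many for a nonzero polynomial. *)
  pose rs := [seq (n%:R : R) | n <- iota 0 (size f)].
  have : (size rs < size f)%N.
    apply: max_poly_roots => //.
      by apply/allP => x _; apply: contraPT all_root => nr; apply; exists x.
    by rewrite map_inj_uniq ?iota_uniq// => a c /eqP; rewrite eqr_nat => /eqP.
  by rewrite size_map size_iota ltnn.
exists (\col_j x ^+ j) => i.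
have : (rVpoly (w i)).[x] != 0.
  apply: contra fx => /eqP r0.
  by rewrite /root /f horner_prod (bigD1 i)//= r0 mul0r.
congr (_ != 0); rewrite (horner_coef_wide x (size_poly _ _)).
  rewrite mxE; apply: eq_bigr => j _.
  by rewrite mxE coef_rVpoly_ord.
Qed.

(** Sending a member [C i] that meets [F] to the index of some [D j] through one
    of its points in [F] is injective, as [D j] meets [F] at most once. *)
Lemma card_fiber_le (T : Type) (I J : finType) (C : I -> set T) (D : J -> set T)
    (F : set T) :
  trivIset setT C ->
  \bigcup_i C i `<=` \bigcup_j D j ->
  (forall j x y, D j x -> D j y -> F x -> F y -> x = y) ->
  (#|[set i | `[< C i `&` F !=set0 >]]%SET| <=
   #|[set j | `[< D j `&` F !=set0 >]]%SET|)%N.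
Proof.
move=> tC CD inj.
have ex (i : I) : exists o : option J, C i `&` F !=set0 ->
    exists j x, [/\ o = Some j, C i x, D j x & F x].
  have [[x [Cx Fx]]|] := pselect (C i `&` F !=set0); last by exists None.
  have [j _ Dx] := CD x (ex_intro2 _ _ i Logic.I Cx).
  by exists (Some j) => _; exists j, x.
have [h hP] := choice ex.
rewrite -(@card_in_imset _ _ h) => [|i i'].
  have someI : injective (@Some J) by move=> ? ? [].
  rewrite -(card_imset _ someI); apply: subset_leq_card.
  apply/fintype.subsetP => _ /imsetP[i] /[1!inE] /asboolP /hP[j [x [-> _ Dx Fx]]] ->.
  by apply: imset_f; rewrite inE; apply/asboolP; exists x.
rewrite 2!inE => /asboolP /hP[j [x [-> Cx Dx Fx]]] /asboolP.
move=> /hP[j' [x' [-> Cx' Dx' Fx']]] [jj'].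
apply: (tC) => //; exists x; split => //.
by rewrite (inj j x x')// jj'.
Qed.

Section Shadow.
Variables (R : realType) (n : nat) (l : 'cV[R]_n).
Let L (x : 'rV[R]_n) : R := (x *m l) 0 0.

Lemma form_seg (u v : 'rV[R]_n) s :
  L (seg_param u v s) = L u + s * L (v - u).
Proof.
rewrite /L /seg_param mulmxDl -scalemxAl.
by move: (u *m l) ((v - u) *m l) => X Y; rewrite !mxE.
Qed.

Lemma formB (u v : 'rV[R]_n) : L (v - u) = L v - L u.
Proof.
rewrite /L mulmxBl.
by move: (u *m l) (v *m l) => X Y; rewrite !mxE.
Qed.

Lemma piece_form_inj (b : bool) (u v x y : 'rV[R]_n) :
  (b -> L (v - u) != 0) -> piece b u v x -> piece b u v y -> L x = L y -> x = y.
Proof.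
case: b => [/(_ isT) l0 [s _ <-] [t _ <-]|_ -> ->//].
by rewrite !form_seg => /addrI /(mulIf l0) ->.
Qed.

(** On a segment the values of the form fill the interval from [low] to [high];
    a point is represented by its value [low]. *)
Definition low (b : bool) u v := if b then Num.min (L u) (L v) else L u.
Definition high u v := Num.max (L u) (L v).

Lemma low_lt_high (b : bool) (u v : 'rV[R]_n) :
  b -> (b -> L (v - u) != 0) -> low b u v < high u v.
Proof.
rewrite /low /high formB => -> /(_ isT); rewrite subr_eq0.
by case: (ltgtP (L u) (L v)) => // ->; rewrite eqxx.
Qed.

(** On a segment, the form takes the value [t] only at the parameter
    [(t - L u) / L (v - u)]. *)
Lemma piece_shadow (b : bool) (u v : 'rV[R]_n) t :
  (b -> L (v - u) != 0) ->
  `[< piece b u v `&` [set x | L x = t] !=set0 >] =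
  shadow b (low b u v) (high u v) t.
Proof.
rewrite /low /high.
case: b => [/(_ isT) l0|_]; apply/asboolP/idP => /=.
- move=> [_ [[s /= + <-] /= <-]]; rewrite in_itv/= form_seg => /andP[s0 s1].
  move: l0; rewrite formB subr_eq0; case: (ltgtP (L u) (L v)) => //= uv _.
    by apply/andP; split; nra.
  by apply/andP; split; nra.
- move=> tuv; exists (seg_param u v ((t - L u) / (L (v - u)))); split; last first.
    by rewrite /= form_seg divfK// addrC subrK.
  exists ((t - L u) / (L (v - u))) => //=; rewrite in_itv/=.
  move: l0 tuv; rewrite formB subr_eq0.
  case: (ltgtP (L u) (L v)) => //= uv _ /andP[t1 t2].
    by rewrite ltr_pdivrMr ?divr_gt0 ?subr_gt0// mul1r ltrD2r.
  rewrite ltr_ndivrMr ?subr_lt0// mul1r ltrD2r t1 andbT.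
  by rewrite -mulrNN -invrN !opprB divr_gt0 ?subr_gt0.
- by move=> [_ [-> /= <-]].
- by move=> /eqP ->; exists u.
Qed.
End Shadow.

(** For a linear form that is not constant on any of the segments, the
    indicators of the images of the pieces add up to the fibre count, which is
    the same for both partitions. *)
Lemma piece_count_unique (R : realType) (n : nat) (I J : finType)
    (A : set 'rV[R]_n) (b : I -> bool) (u v : I -> 'rV[R]_n)
    (b' : J -> bool) (u' v' : J -> 'rV[R]_n) :
  (forall i, b i -> u i != v i) -> (forall j, b' j -> u' j != v' j) ->
  partition [set: I] (fun i => piece (b i) (u i) (v i)) A ->
  partition [set: J] (fun j => piece (b' j) (u' j) (v' j)) A ->
  \sum_i (-1) ^+ b i = \sum_j (-1) ^+ b' j :> int.
Proof.
move=> uv uv' [cI tI _] [cJ tJ _].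
have [l lP] : exists l : 'cV[R]_n,
    (forall i, b i -> ((v i - u i) *m l) 0 0 != 0) /\
    (forall j, b' j -> ((v' j - u' j) *m l) 0 0 != 0).
  pose K := ({i | b i} + {j | b' j})%type.
  pose w (k : K) := match k with inl i => v (val i) - u (val i)
                               | inr j => v' (val j) - u' (val j) end.
  have [|l lP] := @generic_form _ _ _ w.
    by case=> -[i bi] /=; rewrite subr_eq0 eq_sym ?uv ?uv'.
  exists l; split=> i bi; first exact: (lP (inl (exist _ i bi))).
  exact: (lP (inr (exist _ i bi))).
case: lP => lP lP'.
apply: (@shadow_sum_unique _ _ _ _
    (fun i => low l (b i) (u i) (v i)) (fun i => high l (u i) (v i))
    _ (fun j => low l (b' j) (u' j) (v' j)) (fun j => high l (u' j) (v' j))).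
- by move=> i bi; apply: low_lt_high => //; exact: lP.
- by move=> i bi; apply: low_lt_high => //; exact: lP'.
move=> t.
under eq_bigr => i _ do rewrite -(piece_shadow _ (lP i)).
under [RHS]eq_bigr => i _ do rewrite -(piece_shadow _ (lP' i)).
have card_sum (K : finType) (P : pred K) :
    \sum_k (P k)%:Z = #|[set k | P k]%SET|%:Z.
  rewrite cardsE -sum1_card -natz natr_sum [RHS]big_mkcond.
  by apply: eq_bigr => k _; rewrite -topredE /=; case: (P k).
(* Both sums count the pieces met by the fibre [l = t]; compare them by
   injections in both directions. *)
rewrite !card_sum; congr Posz; apply/eqP; rewrite eqn_leq.
apply/andP; split; apply: card_fiber_le => //.
- by move: cI cJ; rewrite /cover => -> ->.
- by move=> j x y Dx Dy <- /= yx; apply: (piece_form_inj _ Dx Dy) (esym yx); apply: lP'.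
- by move: cI cJ; rewrite /cover => -> ->.
- by move=> j x y Dx Dy <- /= yx; apply: (piece_form_inj _ Dx Dy) (esym yx); apply: lP.
Qed.

Lemma sum_by_dim (N n : nat) (k : 'I_N -> nat) :
  (forall j, (k j <= n)%N) ->
  \sum_(i < n.+1) (-1) ^+ i * #|[set j | k j == i]%SET|%:Z
  = \sum_j (-1) ^+ k j :> int.
Proof.
move=> kn.
rewrite [RHS](partition_big (fun j => inord (k j) : 'I_n.+1) xpredT)//=.
apply: eq_bigr => i _; rewrite cardsE -sum1_card -natz natr_sum mulr_sumr.
apply: eq_big => [j|j].
  by rewrite -topredE -val_eqE /= inordK// ltnS.
by rewrite -topredE /= => /eqP ->; rewrite mulr1.
Qed.

Lemma euler_measure_cells (R : realType) (n f0 f1 : nat) (A : set 'rV[R]_n)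
    (p : 'I_f0 -> 'rV[R]_n) (u v : 'I_f1 -> 'rV[R]_n) :
  is_cell_decomposition A p u v ->
  (forall k C, open_cell k C -> C `<=` A -> (k <= 1)%N) ->
  euler_measure A = f0%:Z - f1%:Z.
Proof.
move=> [uv pA] dimA.
pose b (c : 'I_f0 + 'I_f1) : bool := if c is inr _ then true else false.
pose U c := match c with inl i => p i | inr j => u j end.
pose V c := match c with inl i => p i | inr j => v j end.
have bUV c : b c -> U c != V c by case: c => [i|j] // _; exact: uv.
have pA' : partition [set: 'I_f0 + 'I_f1] (fun c => piece (b c) (U c) (V c)) A.
  by rewrite (_ : (fun _ => _) = (fun c => match c with inl i => [set p i]
     | inr j => open_segment (u j) (v j) end)) //; apply/funext; case.
have sumb : \sum_c (-1) ^+ b c = f0%:Z - f1%:Z :> int.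
  by rewrite big_sumType/= !sumr_const !card_ord expr0 expr1 mulNrn !natz.
have exA : is_euler_sum A (f0%:Z - f1%:Z).
  pose C (c : 'I_f0 + 'I_f1) := piece (b c) (U c) (V c).
  exists (f0 + f1)%N, (fun i : 'I_(f0 + f1) => C (fintype.split i)),
    (fun i : 'I_(f0 + f1) => b (fintype.split i) : nat).
  have cell i : open_cell (b (fintype.split i)) (C (fintype.split i)).
    by apply: piece_open_cell; exact: bUV.
  split=> //; last first.
    rewrite sum_by_dim => [|i]; last first.
      by have [_ _ [r [s [E [bb [G [h [-> _]]]]]]]] := cell i; rewrite leq_subr.
    rewrite -sumb (reindex (@unsplit f0 f1))/=; last first.
      by exists (@fintype.split f0 f1) => i _; rewrite ?splitK ?unsplitK.
    by apply: eq_bigr => c _; rewrite unsplitK.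
  have [cA tA nA] := pA'; split.
  - rewrite -cA; apply/seteqP; split => x [i _ xi]; first by exists (fintype.split i).
    by exists (unsplit i) => //=; rewrite unsplitK.
  - by move=> i j _ _ /tA -/(_ Logic.I Logic.I) /(can_inj splitK).
  - by move=> i _; apply: nA.
rewrite /euler_measure; case: xgetP => [c _|/(_ _ exA)//].
move=> [N [C [k [Ccell [cC tC nC] ->]]]].
have CA i : C i `<=` A by rewrite -cC; exact: bigcup_sup.
rewrite sum_by_dim => [|i]; last first.
  by have [_ _ [r [s [E [bb [G [h [-> _]]]]]]]] := Ccell i; rewrite leq_subr.
have /choice[UV UVP] : forall i, exists uv : 'rV[R]_n * 'rV[R]_n,
    ((k i == 1)%N -> uv.1 != uv.2) /\ C i = piece (k i == 1)%N uv.1 uv.2.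
  move=> i; have [|u0 [v0 uvP]] := open_cell_piece (Ccell i).
    exact: (dimA _ (C i)).
  by exists (u0, v0).
rewrite -sumb.
transitivity (\sum_i (-1) ^+ (k i == 1)%N : int).
  apply: eq_bigr => i _; have := dimA _ _ (Ccell i) (CA i).
  by case: (k i) => [|[]].
apply: (@piece_count_unique _ _ _ _ A _ (fun i => (UV i).1) (fun i => (UV i).2)
  _ U V) => //.
  by move=> i; case: (UVP i).
rewrite (_ : (fun i => _) = C) //.
by apply/funext => i; case: (UVP i).
Qed.

(** * Patterns and step functions *)

(** The step functions of pattern [w] on the interval from [l] to 1; letting [l]
    vary makes induction on the pattern possible. *)
Definition steps (R : realType) (T : Type) (l : R) (w : pattern T) (x : seq R)
    (g : R -> T) : Prop :=
  (forall i s, (i <= jumps w)%N ->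
     (l :: rcons x 1)`_i < s < (l :: rcons x 1)`_i.+1 -> g s = pat_a w i) /\
  (forall i, (1 <= i <= jumps w)%N -> g ((l :: rcons x 1)`_i) = pat_b w i).

Lemma pat_aS (T : Type) (a b c : T) (t : seq (T * T)) (i : nat) :
  (i <= size t)%N -> pat_a (a, (b, c) :: t) i.+1 = pat_a (c, t) i.
Proof. by move=> it; apply: set_nth_default; rewrite /= size_map. Qed.

Lemma pat_bS (T : Type) (a b c : T) (t : seq (T * T)) (i : nat) :
  (1 <= i <= size t)%N -> pat_b (a, (b, c) :: t) i.+1 = pat_b (c, t) i.
Proof. by case: i => // i it; apply: set_nth_default; rewrite size_map. Qed.

Lemma steps_cons (R : realType) (T : Type) (l : R) (a b c : T) (t : seq (T * T))
    (y : R) (x : seq R) (g : R -> T) :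
  steps l (a, (b, c) :: t) (y :: x) g <->
  [/\ forall s, l < s < y -> g s = a, g y = b & steps y (c, t) x g].
Proof.
split=> [[ga gb]|[ga gb [gta gtb]]].
  split=> [s ys||]; [exact: (ga 0)|exact: (gb 1)|split=> [i s it si|i it]].
    by rewrite -(pat_aS a b)//; exact: (ga i.+1).
  by rewrite -(pat_bS a b)//; apply: (gb i.+1); case/andP: it.
split=> [[|i] s it si|[//|[|i]] it].
- exact: ga.
- by rewrite pat_aS//; exact: (gta i).
- exact: gb.
- by rewrite pat_bS//; exact: (gtb i.+1).
Qed.

Lemma steps_nil (R : realType) (T : Type) (l : R) (a : T) (g : R -> T) :
  steps l (a, [::]) [::] g <-> forall s, l < s < 1 -> g s = a.
Proof.
split=> [[ga _] s|ga]; first exact: (ga 0).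
by split=> [[|//] s _|[|i] //]; exact: ga.
Qed.

Lemma admissible_cons (T : Type) (a b c : T) (t : seq (T * T)) :
  admissible (a, (b, c) :: t) <-> ~ (a = b /\ b = c) /\ admissible (c, t).
Proof.
split=> [adm|[abc adm] [//|[|i]] it].
- split; first exact: (adm 1).
  case=> // i /= it; rewrite -(@pat_aS _ a b c t i) ?(ltnW it)//.
  by rewrite -(@pat_bS _ a b c t)// -(@pat_aS _ a b c t i.+1)//; exact: (adm i.+2).
- exact: abc.
- by rewrite [i.+2.-1]/= pat_bS// !pat_aS//; [exact: (adm i.+1)|exact: ltnW].
Qed.

Lemma path_lt1 (R : realType) (y : R) (x : seq R) :
  path <%R y (rcons x 1) -> y < 1.
Proof.
move=> /(order_path_min lt_trans) /allP; apply.
by rewrite mem_rcons mem_head.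
Qed.

Lemma steps_start (R : realType) (T : Type) (l : R) (w : pattern T) (x : seq R)
    (g : R -> T) :
  path <%R l (rcons x 1) -> steps l w x g ->
  exists2 r, l < r & forall s, l < s < r -> g s = w.1.
Proof.
move=> px [ga _]; exists (rcons x 1)`_0; last by move=> s; exact: (ga 0).
by case: x px {ga} => [|? ?] /= /andP[].
Qed.

(** By induction on the patterns.  The initial values agree.  If one list of
    break points is exhausted or has a later head, then [g] keeps its initial
    value at and just after the first break point [y] of the other one, against
    admissibility ([nojump]).  So the first break points agree, as do the values
    there, and the induction hypothesis applies from this point on. *)
Lemma steps_unique (R : realType) (T : Type) (l : R) (w w' : pattern T)
    (x x' : seq R) (g : R -> T) :
  admissible w -> size x = jumps w -> path <%R l (rcons x 1) -> steps l w x g ->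
  admissible w' -> size x' = jumps w' -> path <%R l (rcons x' 1) ->
  steps l w' x' g -> w = w'.
Proof.
have agree (k : R) (v v' : pattern T) (z z' : seq R) :
    path <%R k (rcons z 1) -> steps k v z g -> path <%R k (rcons z' 1) ->
    steps k v' z' g -> v.1 = v'.1.
  move=> pz /(steps_start pz)[r kr gr] pz' /(steps_start pz')[r' kr' gr'].
  pose q := Num.min r r'.
  have kq : k < q by rewrite lt_min kr.
  have qr : q <= r by rewrite ge_min lexx.
  have qr' : q <= r' by rewrite ge_min lexx orbT.
  by rewrite -(gr ((k + q) / 2)) ?(gr' ((k + q) / 2))//; lra.
(* An admissible pattern does not keep its initial value on an interval that
   reaches beyond its first break point. *)
have nojump (k y z : R) (a b c : T) (t : seq (T * T)) (r : seq R) :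
    admissible (a, (b, c) :: t) -> path <%R k (rcons (y :: r) 1) ->
    steps k (a, (b, c) :: t) (y :: r) g -> y < z ->
    (forall s, k < s < z -> g s = a) -> False.
  move=> /admissible_cons[abc _] /= /andP[ky py] /steps_cons[_ gy st] yz ga.
  apply: abc; split; first by rewrite -gy ga// ky.
  have [q yq gc] := steps_start py st.
  rewrite -gy ga ?ky//.
  pose o := Num.min z q.
  have yo : y < o by rewrite lt_min yz.
  have oz : o <= z by rewrite ge_min lexx.
  have oq : o <= q by rewrite ge_min lexx orbT.
  by rewrite -[RHS](gc ((y + o) / 2)) ?ga//; lra.
case: w w' => a t [a' t'].
elim: t a l x a' t' x' => [|[b c] t IH] a l x a' [|[b' c'] t'] x' adm sx px st
  adm' sx' px' st'.
- by congr pair; exact: (agree _ _ _ _ _ px st px' st').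
- have /= aa := agree _ _ _ _ _ px st px' st'; subst a'.
  case: x sx px st => // _ _ /steps_nil ga.
  case: x' sx' px' st' => // y x' _ px' st'; exfalso.
  apply: (nojump _ _ 1 _ _ _ _ _ adm' px' st' _ ga).
  by move: px' => /= /andP[_ /path_lt1].
- have /= aa := agree _ _ _ _ _ px st px' st'; subst a'.
  case: x' sx' px' st' => // _ _ /steps_nil ga.
  case: x sx px st => // y x _ px st; exfalso.
  apply: (nojump _ _ 1 _ _ _ _ _ adm px st _ ga).
  by move: px => /= /andP[_ /path_lt1].
have /= aa := agree _ _ _ _ _ px st px' st'; subst a'.
case: x sx px st => // y x [sx] px st.
case: x' sx' px' st' => // y' x' [sx'] px' st'.
have [ga gy st1] := (steps_cons _ _ _ _ _ _ _ _).1 st.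
have [ga' gy' st1'] := (steps_cons _ _ _ _ _ _ _ _).1 st'.
have [yy|yy|yy] := ltgtP y y'.
- by exfalso; exact: (nojump _ _ _ _ _ _ _ _ adm px st yy ga').
- by exfalso; exact: (nojump _ _ _ _ _ _ _ _ adm' px' st' yy ga).
subst y'; have bb : b = b' by rewrite -gy.
subst b'; move: px px' => /= /andP[_ px] /andP[_ px'].
have [_ adm1] := (admissible_cons _ _ _ _).1 adm.
have [_ adm1'] := (admissible_cons _ _ _ _).1 adm'.
by have [-> ->] := IH _ _ _ _ _ _ adm1 sx px st1 adm1' sx' px' st1'; rewrite bb.
Qed.

Fixpoint step_fun (R : realType) (T : Type) (a : T) (t : seq (T * T)) (x : seq R)
    (s : R) : T :=
  match t, x with
  | (b, c) :: t', y :: x' =>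
      if s < y then a else if s == y then b else step_fun c t' x' s
  | _, _ => a
  end.

Lemma step_funP (R : realType) (T : Type) (l : R) (w : pattern T) (x : seq R)
    (g : R -> T) :
  size x = jumps w -> path <%R l (rcons x 1) ->
  (forall s, l < s < 1 -> g s = step_fun w.1 w.2 x s) -> steps l w x g.
Proof.
case: w => a t; elim: t a l x => [|[b c] t IH] a l [|y x] //=.
  by move=> _ _ gE; apply/steps_nil.
move=> [sx] /andP[ly py] gE.
have y1 := path_lt1 py.
apply/steps_cons; split=> [s /andP[ls sy]||].
- by rewrite gE ?sy// ls (lt_trans sy).
- by rewrite gE ?ltxx ?eqxx// ly.
apply: IH => // s /andP[ys s1].
by rewrite gE ?s1 ?(lt_trans ly)//= ltNge (ltW ys)/= gt_eqF.
Qed.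

Lemma breaks_lt (R : realType) (x : seq R) i j :
  sorted <%R (breaks x) -> (i < j)%N -> (j <= (size x).+1)%N ->
  (breaks x)`_i < (breaks x)`_j.
Proof.
move=> sx ij jx; rewrite lt_sorted_ltn_nth// inE /= size_rcons ltnS//.
exact: leq_trans (ltnW ij) jx.
Qed.

Lemma breaks_last (R : realType) (x : seq R) : (breaks x)`_(size x).+1 = 1.
Proof. by rewrite /= nth_rcons ltnn eqxx. Qed.

Lemma step_value_steps (R : realType) (T : Type) (w : pattern T) (x : seq R)
    (g : R -> T) :
  open_simplex (jumps w) x ->
  (forall s, 0 < s < 1 -> step_value w x s (g s)) <-> steps 0 w x g.
Proof.
move=> [sx px].
have br0 i : (i <= jumps w)%N -> 0 <= (breaks x)`_i.
  case: i => // i ik; apply/ltW/(@breaks_lt _ _ 0) => //.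
  by rewrite sx ltnW.
have br1 i : (i < (jumps w).+2)%N -> (breaks x)`_i <= 1.
  rewrite !ltnS leq_eqVlt => /predU1P[->|ik].
    by rewrite -sx breaks_last.
  by rewrite -(breaks_last x) ltW// breaks_lt// sx.
split=> [gv|[ga gb] s s01].
  split=> [i s ik /andP[si1 si2]|i /andP[i0 ik]].
    have [|ga _] := gv s.
      by rewrite (le_lt_trans (br0 _ ik))// (lt_le_trans si2)// br1.
    by apply: ga => //; rewrite si1.
  have [|_ hb] := gv (breaks x)`_i; last by apply: (hb i); rewrite ?i0.
  rewrite (@breaks_lt _ _ 0)// ?sx ?(leq_trans ik)//=.
  by rewrite -[X in _ < X](breaks_last x) breaks_lt// sx ltnS.
by split=> [i ik si|i ik ->]; [exact: ga|exact: gb].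
Qed.

(** * Polyhedra *)

Lemma polyhedronT (R : realType) (n : nat) : polyhedron [set: 'rV[R]_n].
Proof.
have -> : [set: 'rV[R]_n] = [set x | (x *m (0 : 'cV_n)) 0 0 = 0].
  by apply/esym/seteqP; split => // x _; rewrite /= mulmx0 mxE.
exact: polyhedron_eq.
Qed.

Lemma polyhedron_forall (R : realType) (n : nat) (I : finType)
    (A : I -> set 'rV[R]_n) :
  (forall i, polyhedron (A i)) -> polyhedron [set x | forall i, A i x].
Proof.
move=> pA.
have pS (s : seq I) : polyhedron [set x | forall i, i \in s -> A i x].
  elim: s => [|i s IH].
    rewrite (_ : [set _ | _] = setT); first exact: polyhedronT.
    by apply/seteqP; split.
  rewrite (_ : [set _ | _] = A i `&` [set x | forall j, j \in s -> A j x]).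
    exact: polyhedronI.
  apply/seteqP; split => [x /= Ax|x [/= Ai As] j].
    split=> [|j js]; apply: Ax; rewrite inE ?eqxx// js orbT.
    by [].
  by rewrite inE => /predU1P[->|/As].
rewrite (_ : [set _ | _] = [set x | forall i, i \in enum I -> A i x]) //.
apply/seteqP; split => x /= Ax i; first by move=> _.
by apply: Ax; rewrite mem_enum.
Qed.

Lemma polyhedron_exists (R : realType) (n : nat) (I : finType)
    (A : I -> set 'rV[R]_n) :
  (forall i, polyhedron (A i)) -> polyhedron [set x | exists i, A i x].
Proof.
move=> pA.
rewrite (_ : [set _ | _] = ~` [set x | forall i, (~` A i) x]).
  by apply: polyhedronC; apply: polyhedron_forall => i; exact: polyhedronC.
apply/seteqP; split => [x [i Ai] /(_ i)//|x /= nA].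
by apply: contrapT => nex; apply: nA => i Ai; apply: nex; exists i.
Qed.

Lemma open_cell_polyhedron (R : realType) (n k : nat) (C : set 'rV[R]_n) :
  open_cell k C -> polyhedron C.
Proof.
move=> [_ _ [r [s [E [b [G [h [_ ->]]]]]]]].
have mulcol q (M : 'M[R]_(n, q)) (x : 'rV[R]_n) j :
    (x *m col j M) 0 0 = (x *m M) 0 j.
  by rewrite !mxE; apply: eq_bigr => i _; rewrite mxE.
rewrite (_ : [set _ | _] =
   [set x | forall j, [set y | (y *m col j E) 0 0 = b 0 j] x] `&`
   [set x | forall j, (~` [set y | (y *m (- col j G)) 0 0 <= - h 0 j]) x]).
  apply: polyhedronI; apply: polyhedron_forall => j; first exact: polyhedron_eq.
  by apply: polyhedronC; exact: polyhedron_le.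
have negE (x : 'rV[R]_n) j : (x *m - col j G) 0 0 <= - h 0 j = (h 0 j <= (x *m G) 0 j).
  have -> : (x *m - col j G) 0 0 = - (x *m G) 0 j.
    by rewrite mulmxN -mulcol; move: (x *m _) => X; rewrite mxE.
  by rewrite lerN2.
apply/seteqP; split => x [/= xE xG]; split.
- by move=> j /=; rewrite mulcol xE.
- by move=> j /=; rewrite negE; apply/negP; rewrite -ltNge.
- by apply/rowP => j; rewrite -mulcol.
- by move=> j; have /negP := xG j; rewrite negE -ltNge.
Qed.

Lemma polyhedron_set1 (R : realType) (n : nat) (u : 'rV[R]_n) :
  polyhedron [set u].
Proof.
by apply: (@open_cell_polyhedron _ _ false); exact: (@piece_open_cell _ _ false u u).
Qed.

Lemma polyhedron_open_segment (R : realType) (n : nat) (u v : 'rV[R]_n) :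
  polyhedron (open_segment u v).
Proof.
have [->|uv] := eqVneq u v.
  rewrite (_ : open_segment v v = [set v]); first exact: polyhedron_set1.
  apply/seteqP; split => [_ [s _ <-]|_ ->].
    by rewrite /seg_param subrr scaler0 addr0.
  exists 2^-1; rewrite /seg_param ?subrr ?scaler0 ?addr0//=.
  by rewrite in_itv/= invr_gt0 invf_lt1 ?ltr0n ?ltr1n.
apply: (@open_cell_polyhedron _ _ true); exact: (@piece_open_cell _ _ true).
Qed.

Lemma polyhedron_const_piece (R : realType) (d n : nat) (u v : 'rV[R]_d)
    (a : 'rV[R]_n) (l r : R) :
  l < r ->
  polyhedron [set row_mx (seg_param u v s) a | s in [set s | l < s < r]].
Proof.
move=> lr.
rewrite (_ : [set _ | _ in _] = open_segment (row_mx (seg_param u v l) a)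
                                             (row_mx (seg_param u v r) a)).
  exact: polyhedron_open_segment.
have segE t : seg_param (row_mx (seg_param u v l) a) (row_mx (seg_param u v r) a) t
    = row_mx (seg_param u v (l + t * (r - l))) a.
  rewrite /seg_param opp_row_mx add_row_mx subrr scale_row_mx add_row_mx.
  by rewrite scaler0 addr0 addrKAl -scalerBl scalerA -addrA -scalerDl.
apply/seteqP; split => [_ [s /= /andP[ls sr] <-]|_ [t /= /[!in_itv]/= /andP[t0 t1] <-]].
  exists ((s - l) / (r - l)).
    by rewrite /= in_itv/= divr_gt0 ?subr_gt0//= ltr_pdivrMr ?subr_gt0// mul1r ltrD2r.
  by rewrite segE divfK ?subr_eq0 ?gt_eqF// [l + _]addrC subrK.
exists (l + t * (r - l)); rewrite ?segE//=.
by apply/andP; split; nra.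
Qed.

(** By induction: a segment, a point, and the graph of the remaining steps. *)
Lemma polyhedron_step_graph (R : realType) (d n : nat) (P : set 'rV[R]_n)
    (u v : 'rV[R]_d) (l : R) (a : P) (t : seq (P * P)) (x : seq R) :
  size x = size t -> path <%R l (rcons x 1) ->
  polyhedron [set row_mx (seg_param u v s) (\val (step_fun a t x s))
             | s in [set s | l < s < 1]].
Proof.
elim: t a l x => [|[b c] t IH] a l [|y x] //=.
  by move=> _ /andP[l1 _]; exact: polyhedron_const_piece.
move=> [sx] /andP[ly py].
have y1 := path_lt1 py.
rewrite (_ : [set _ | _ in _] =
  [set row_mx (seg_param u v s) (\val a) | s in [set s | l < s < y]] `|`
  ([set row_mx (seg_param u v y) (\val b)] `|`
   [set row_mx (seg_param u v s) (\val (step_fun c t x s)) | s in [set s | y < s < 1]])).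
  apply: polyhedronU; first exact: polyhedron_const_piece.
  by apply: polyhedronU; [exact: polyhedron_set1|exact: IH].
apply/seteqP; split => [_ [s /= /andP[ls s1] <-]|_ [[s /= /andP[ls sy] <-]|
   [->|[s /= /andP[ys s1] <-]]]].
- case: ltgtP => [sy|ys|->]; [left|right; right|right; left] => //.
    by exists s => //=; rewrite ls.
  by exists s => //=; rewrite ys.
- by exists s; rewrite /= ?sy// ls (lt_trans sy).
- by exists y; rewrite /= ?ltxx ?eqxx// ly.
- by exists s; rewrite /= ?(lt_trans ly)// ltNge (ltW ys)/= gt_eqF.
Qed.

(** * The data of a cell of maps are determined by any of its maps *)

Lemma open_simplex_nonempty (R : realType) (k : nat) :
  (open_simplex k : set (seq R)) !=set0.
Proof.
suff ex (l : R) : l < 1 -> exists x : seq R, size x = k /\ path <%R l (rcons x 1).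
  by have [x xP] := ex 0 ltr01; exists x.
elim: k l => [|k IH] l l1; first by exists [::]; rewrite /= l1.
have [|x [sx px]] := IH ((l + 1) / 2); first by lra.
exists ((l + 1) / 2 :: x); split; first by rewrite /= sx.
by rewrite /= px andbT; lra.
Qed.

Section Cells.
Variables (R : realType) (n d f0 f1 : nat) (P : set 'rV[R]_n) (Q : set 'rV[R]_d).
Variables (p : 'I_f0 -> 'rV[R]_d) (u v : 'I_f1 -> 'rV[R]_d).
Hypothesis dec : is_cell_decomposition Q p u v.

Let cell (c : 'I_f0 + 'I_f1) : set 'rV[R]_d :=
  match c with inl i => [set p i] | inr j => open_segment (u j) (v j) end.

Lemma cell_sub c x : cell c x -> Q x.
Proof. by case: dec => _ [<- _ _] cx; exists c. Qed.

Lemma cell_inj c c' x : cell c x -> cell c' x -> c = c'.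
Proof. by case: dec => _ [_ tQ _] cx cx'; apply: tQ => //; exists x. Qed.

Lemma seg_cell j s : 0 < s < 1 -> cell (inr j) (seg_param (u j) (v j) s).
Proof. by move=> s01; exists s; rewrite //= in_itv. Qed.

Lemma seg_param_inj j : injective (seg_param (u j) (v j)).
Proof.
have [uv _] := dec; move=> s t /addrI /eqP.
rewrite -subr_eq0 -scalerBl scaler_eq0 subr_eq0 [v j - _ == 0]subr_eq0.
by rewrite [v j == _]eq_sym (negbTE (uv j)) orbF => /eqP.
Qed.

Definition point_of (x : 'rV[R]_d) (Qx : Q x) : Q := exist _ x (mem_set Qx).

(** The cells of [Q] are disjoint, so maps may be prescribed on them
    independently. *)
Lemma glue (a : 'I_f0 -> P) (g : 'I_f1 -> R -> P) :
  exists f : Q -> P,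
    (forall i q, \val q = p i -> f q = a i) /\
    (forall j s q, 0 < s < 1 -> \val q = seg_param (u j) (v j) s -> f q = g j s).
Proof.
have ex (q : Q) : exists y : P, (forall i, \val q = p i -> y = a i) /\
    (forall j s, 0 < s < 1 -> \val q = seg_param (u j) (v j) s -> y = g j s).
  have : Q (\val q) by exact: set_valP.
  have [_ [cQ _ _]] := dec; rewrite -[X in X _ -> _]cQ => -[[i|j] _ cq].
    exists (a i); split => [i' qi'|j s s01 qs].
      have [->//] : inl i = inl i' :> 'I_f0 + 'I_f1.
      exact: (@cell_inj (inl i) (inl i') _ cq).
    by have := cell_inj (cq : cell (inl i) _) (x := \val q) (c' := inr j);
       rewrite qs => /(_ (seg_cell j s01)).
  have [s /= s01 sq] := cq; rewrite in_itv/= in s01.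
  exists (g j s); split => [i' qi'|j' s' s01' qs].
    by have := cell_inj (cq : cell (inr j) _) (x := \val q) (c' := inl i') qi'.
  have [jj] : inr j = inr j' :> 'I_f0 + 'I_f1.
    by apply: (cell_inj (x := \val q)) => //; by have := seg_cell j' s01'; rewrite -qs.
  by subst j'; rewrite (@seg_param_inj j s s')// sq.
have [f fP] := choice ex.
by exists f; split => [i q|j s q] *; [apply: (fP q).1|apply: (fP q).2].
Qed.

(** Any break points will do; the graph of the resulting map is a finite union
    of points and graphs of step functions. *)
Lemma map_cell_nonempty (a : 'I_f0 -> P) (w : 'I_f1 -> pattern P) :
  (map_cell p u v a w : set (Q -> P)) !=set0.
Proof.
have /choice[x xP] : forall j, exists x, (open_simplex (jumps (w j)) : set (seq R)) x.
  by move=> j; exact: open_simplex_nonempty.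
pose g j := step_fun (w j).1 (w j).2 (x j).
have [f [fa fg]] := glue a g.
exists f; split=> //; last first.
  move=> j; exists (x j) => // s q s01 qs; rewrite (fg j s)//.
  have [sx px] := xP j.
  by apply: (step_value_steps _ (xP j)).2 => //; exact: step_funP.
rewrite /polyhedral_map.
rewrite (_ : graph f =
  [set z | exists i, [set row_mx (p i) (\val (a i))] z] `|`
  [set z | exists j, [set row_mx (seg_param (u j) (v j) s) (\val (g j s))
                     | s in [set s | 0 < s < 1]] z]).
  apply: polyhedronU; apply: polyhedron_exists => j; first exact: polyhedron_set1.
  by have [sx px] := xP j; exact: polyhedron_step_graph.
apply/seteqP; split => [_ [q _ <-]|_ [[i ->]|[j [s /= s01 <-]]]].
- have : Q (\val q) by exact: set_valP.
  have [_ [cQ _ _]] := dec; rewrite -[X in X _ -> _]cQ => -[[i|j] _].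
    by move=> qi; left; exists i; rewrite /= -(fa i q)// qi.
  move=> [s /= + sq]; rewrite in_itv/= => s01; right; exists j, s => //.
  by rewrite /= -sq (fg j s q).
- have Qp : Q (p i) by exact: (@cell_sub (inl i)).
  by exists (point_of Qp); rewrite // (fa i).
- have Qs : Q (seg_param (u j) (v j) s) by exact: (cell_sub (seg_cell j s01)).
  by exists (point_of Qs); rewrite // (fg j s).
Qed.

(** A common map restricts on each 1-cell to a step function of both patterns,
    and [steps_unique] applies. *)
Lemma map_cell_disjoint (a a' : 'I_f0 -> P) (w w' : 'I_f1 -> pattern P) (f : Q -> P) :
  (forall j, admissible (w j)) -> (forall j, admissible (w' j)) ->
  map_cell p u v a w f -> map_cell p u v a' w' f -> a = a' /\ w = w'.
Proof.
move=> adm adm' [_ fa fw] [_ fa' fw']; split; apply: funext => i.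
  have Qp : Q (p i) by exact: (@cell_sub (inl i)).
  by rewrite -(fa i (point_of Qp))// (fa' i).
have [x xP xv] := fw i; have [x' xP' xv'] := fw' i.
have half : 0 < (2^-1 : R) < 1 by lra.
(* [g] is [f] along the segment; outside ]0, 1[ an arbitrary value is taken. *)
have /choice[g gP] (s : R) : exists y : P, forall q : Q, 0 < s < 1 ->
    \val q = seg_param (u i) (v i) s -> f q = y.
  have [s01|s01] := boolP (0 < s < 1).
    exists (f (point_of (cell_sub (seg_cell i s01)))) => q _ qs.
    by congr f; apply: val_inj.
  by exists (f (point_of (cell_sub (seg_cell i half)))).
have fE s (s01 : 0 < s < 1) : f (point_of (cell_sub (seg_cell i s01))) = g s.
  exact: gP.
have [sx px] := xP; have [sx' px'] := xP'.
apply: (@steps_unique _ _ 0 _ _ x x' g) => //.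
  by apply/(step_value_steps _ xP) => s s01; rewrite -(fE s s01); exact: xv.
by apply/(step_value_steps _ xP') => s s01; rewrite -(fE s s01); exact: xv'.
Qed.
End Cells.

(** * Counting families of patterns *)

Section Families.
Variables (T : eqType) (e : seq T).

(** For [ab = (a, b)], the first pattern [(c, ...)] becomes [(a, (b, c), ...)]. *)
Definition prepend_jump (F : seq (pattern T)) (ab : T * T) : seq (pattern T) :=
  if F is (c, t) :: F' then (ab.1, (ab.2, c) :: t) :: F' else [::].

(** The pairs that may be prepended without losing admissibility. *)
Definition jumps_into (F : seq (pattern T)) : seq (T * T) :=
  if F is (c, _) :: _ then
    [seq ab <- [seq (a, b) | a <- e, b <- e] | ab != (c, c)]
  else [::].

(** The lists of [f] admissible patterns with values in [e] and [k] jumps in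
    all.  The double recursion follows the recurrence for their number: a first
    pattern without jumps, or one more jump in front of the first pattern. *)
Fixpoint families (f : nat) : nat -> seq (seq (pattern T)) :=
  if f is f'.+1 then fix families_f k :=
    [seq (a, [::]) :: F | a <- e, F <- families f' k] ++
    (if k is k'.+1 then
       [seq prepend_jump F ab | F <- families_f k', ab <- jumps_into F]
     else [::])
  else fun k => if k is 0%N then [:: [::]] else [::].

Lemma familiesSS f k : families f.+1 k.+1 =
  [seq (a, [::]) :: F | a <- e, F <- families f k.+1] ++
  [seq prepend_jump F ab | F <- families f.+1 k, ab <- jumps_into F].
Proof. by []. Qed.

Lemma familiesS0 f : families f.+1 0 =
  [seq (a, [::]) :: F | a <- e, F <- families f 0].
Proof. by rewrite /= cats0. Qed.

Hypotheses (uniq_e : uniq e) (full_e : forall x, x \in e).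

Lemma admissible_jump (a b c : T) (t : seq (T * T)) :
  admissible (a, (b, c) :: t) <-> (a, b) != (c, c) /\ admissible (c, t).
Proof.
rewrite admissible_cons; split => -[abc adm]; split => //.
  by apply/eqP => -[ac bc]; apply: abc; rewrite ac bc.
by move=> [ab bc]; move/eqP: abc; apply; rewrite ab bc.
Qed.

Lemma mem_jumps_into c t F ab :
  (ab \in jumps_into ((c, t) :: F)) = (ab != (c, c)).
Proof.
rewrite mem_filter andb_idr// => _; case: ab => a b.
by apply/allpairsP; exists (a, b).
Qed.

Lemma mem_families f k F :
  F \in families f k <->
  [/\ size F = f, forall w, w \in F -> admissible w & sumn (map (@jumps T) F) = k].
Proof.
elim: f k F => [|f IHf] k F.
  case: k => [|k]; split => //=.
  - by rewrite inE => /eqP ->.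
  - by case: F => [|w F] [].
  - by case: F => [|w F] [].
have cons0 k' a F' :
  (a, [::]) :: F' \in [seq (a, [::]) :: F | a <- e, F <- families f k'] <->
   [/\ size ((a, [::]) :: F' : seq (pattern T)) = f.+1,
     forall w, w \in (a, [::]) :: F' -> admissible w
     & sumn (map (@jumps T) ((a, [::]) :: F')) = k'].
  split=> [/allpairsP[[a1 F1] /= [_ /IHf[sF aF jF] [-> ->]]]|[[sF] aF jF]].
    split=> [|w|]; rewrite /= ?sF//.
    by rewrite inE => /predU1P[-> [|i]//|/aF].
  apply/allpairsP; exists (a, F'); split => //=; apply/IHf; split => // w wF.
  by apply: aF; rewrite inE wF orbT.
have nil0 k' w F' : w.2 != [::] ->
    (w :: F' \notin [seq (a, [::]) :: F | a <- e, F <- families f k']).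
  by move=> w2; apply/allpairsP => -[[a1 F1] /= [_ _ [wE _]]]; rewrite wE in w2.
elim: k F => [|k IHk] F.
  rewrite familiesS0; case: F => [|[a [|[b c] t]] F].
  - by split; [case/allpairsP => -[? ?] [] | case].
  - exact: cons0.
  - by split; [rewrite (negbTE (nil0 _ _ _ _))|case].
rewrite familiesSS mem_cat.
case: F => [|[a [|[b c] t]] F].
- split; last by case.
  case/orP => /allpairsPdep[x [y [xe]]]; first by [].
  by move: xe => /IHk[]; case: x => // -[].
- rewrite -cons0; split=> [/orP[//|]|->//].
  by case/allpairsPdep => -[|[c t] F1] [ab [_ _]].
- rewrite (negbTE (nil0 _ _ _ _))//=; split.
    case/allpairsPdep => -[|[c1 t1] F1] [[a1 b1] [/IHk[sF aF jF] + //]].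
    rewrite mem_jumps_into => abc [-> -> -> -> ->]; split => //=.
    + move=> w; rewrite inE => /predU1P[->|wF].
        by apply/admissible_jump; split => //; apply: aF; rewrite mem_head.
      by apply: aF; rewrite inE wF orbT.
    + by rewrite -jF.
  move=> [sF aF jF].
  have /admissible_jump[abc adm] := aF _ (mem_head _ _).
  apply/allpairsPdep; exists ((c, t) :: F), (a, b); split => //.
    apply/IHk; split => //=.
      by move=> w; rewrite inE => /predU1P[->//|wF]; apply: aF; rewrite inE wF orbT.
    by case: jF => <-.
  by rewrite mem_jumps_into.
Qed.

Lemma uniq_families f k : uniq (families f k).
Proof.
elim: f k => [|f IHf]; first by case.
have u0 k : uniq [seq (a, [::]) :: F | a <- e, F <- families f k].
  by apply: allpairs_uniq => // -[a F] [a' F'] _ _ [-> ->].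
elim=> [|k IHk]; first by rewrite familiesS0.
rewrite familiesSS cat_uniq u0 andTb; apply/andP; split.
  apply/hasPn => _ /allpairsPdep[F [ab [/mem_families[sF _ _] _ ->]]].
  case: F sF => // -[c t] F _ /=.
  by apply/negP => /allpairsP[[a' F'] /= [_ _ []]].
apply: allpairs_uniq_dep => //.
  move=> [//|[c t] F _]; apply: filter_uniq; apply: allpairs_uniq => //.
  by move=> [? ?] [? ?] _ _ [-> ->].
move=> [F [a b]] [F' [a' b']].
move=> /allpairsPdep[F1 [ab1 [/mem_families[s1 _ _] _ [-> _]]]].
move=> /allpairsPdep[F2 [ab2 [/mem_families[s2 _ _] _ [-> _]]]].
case: F1 s1 => // -[c1 t1] F1 _; case: F2 s2 => // -[c2 t2] F2 _ /=.
by case=> -> -> -> -> ->.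
Qed.

Lemma size_familiesS0 f :
  size (families f.+1 0) = (size e * size (families f 0))%N.
Proof. by rewrite familiesS0 size_allpairs. Qed.

Lemma size_familiesSS f k :
  size (families f.+1 k.+1) = (size e * size (families f k.+1)
    + (size e ^ 2 - 1) * size (families f.+1 k))%N.
Proof.
rewrite familiesSS size_cat size_allpairs; congr addn.
rewrite size_allpairs_dep.
have -> : [seq size (jumps_into F) | F <- families f.+1 k] =
          [seq (size e ^ 2 - 1)%N | F <- families f.+1 k].
  apply/eq_in_map => -[|[c t] F] /mem_families[//] _ _ _.
  rewrite /jumps_into size_filter.
  have := count_predC (pred1 (c, c)) [seq (a, b) | a <- e, b <- e].
  rewrite size_allpairs mulnn => <-; rewrite -[X in _ = (X + _ - _)%N]/(count_mem _ _).
  rewrite count_uniq_mem.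
    have -> : (c, c) \in [seq (a, b) | a <- e, b <- e].
      by apply/allpairsP; exists (c, c).
    by rewrite addKn.
  by apply: allpairs_uniq => // -[? ?] [? ?] _ _ [-> ->].
by elim: (families _ _) => [|x s IHs]; rewrite /= ?muln0 ?mulnS ?IHs.
Qed.
End Families.

Arguments families : simpl never.

(** * Generating series *)

(** The deviation [D n] from the limit satisfies [D n.+1 = q * D n + o(1)];
    once the error term is below [e / 2 * (1 - `|q|)], the bound
    [`|q| ^+ k * `|D N| + e / 2] propagates. *)
Lemma affine_recurrence_cvg (R : realType) (q l : R) (y z : R ^nat) :
  `|q| < 1 -> (forall n, y n.+1 = q * y n + z n) ->
  z n @[n --> \oo] --> l -> y n @[n --> \oo] --> l / (1 - q).
Proof.
move=> q1 yS zl.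
have q1' : 1 - q != 0.
  by rewrite subr_eq0 eq_sym; apply: contraTneq q1 => ->; rewrite normr1 ltxx.
pose D n := y n - l / (1 - q).
have DS n : D n.+1 = q * D n + (z n - l).
  by rewrite /D yS; field.
apply/cvgrPdist_le => e e0.
have e1 : 0 < e / 2 * (1 - `|q|) by rewrite mulr_gt0 ?subr_gt0// divr_gt0.
move/cvgrPdist_le : zl => /(_ _ e1) [N _ zN].
have bound k : `|D (k + N)%N| <= `|q| ^+ k * `|D N| + e / 2.
  elim: k => [|k IH]; first by rewrite add0n expr0 mul1r lerDl ltW// divr_gt0.
  rewrite addSn DS (le_trans (ler_normD _ _))// normrM.
  have zk : `|z (k + N)%N - l| <= e / 2 * (1 - `|q|).
    by rewrite distrC; apply: zN; rewrite /= leq_addl.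
  apply: (le_trans (lerD (ler_wpM2l (normr_ge0 q) IH) zk)).
  rewrite exprS; set A := `|q| ^+ k; set B := `|D N|.
  by rewrite le_eqVlt; apply/orP; left; apply/eqP; field.
have qk : `|q| ^+ k * `|D N| @[k --> \oo] --> (0 : R).
  rewrite -[0](mul0r `|D N|); apply: cvgM; last exact: cvg_cst.
  by apply: cvg_expr; rewrite normr_id.
have e2 : 0 < e / 2 by rewrite divr_gt0.
move/cvgrPdist_le : qk => /(_ _ e2) [M _ qM].
exists (M + N)%N => // n /= MNn.
have Nn : (N <= n)%N := leq_trans (leq_addl _ _) MNn.
rewrite distrC -/(D n) -(subnK Nn) (le_trans (bound _))//.
rewrite [leRHS](splitr e) lerD2r.
have : (M <= n - N)%N by rewrite leq_subRL// addnC.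
move=> /qM /=; rewrite sub0r normrN ger0_norm// mulr_ge0// exprn_ge0//.
Qed.

Lemma families_gf (R : realType) (T : eqType) (e : seq T) (f : nat) (t : R) :
  uniq e -> (forall x, x \in e) -> (0 < size e)%N ->
  `|((size e)%:R ^+ 2 - 1) * t| < 1 ->
  pseries (fun k => (size (families e f k))%:R) t @ \oo -->
  ((size e)%:R / (1 - ((size e)%:R ^+ 2 - 1) * t)) ^+ f.
Proof.
move=> ue fe me; set m := (size e)%:R; set q := (_ * t) => q1.
elim: f => [|f IHf].
  rewrite expr0 -(cvg_shiftS _); apply: cvg_near_cst; near=> n.
  rewrite /pseries /series/= big_nat_recl//= mulr1 big1_seq ?addr0//.
  by move=> i _; rewrite mul0r.
set y := pseries _ _ in IHf *.
have yS : forall n, pseries (fun k => (size (families e f.+1 k))%:R) t n.+1 =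
  q * pseries (fun k => (size (families e f.+1 k))%:R) t n + m * y n.+1.
  move=> n; rewrite /y /pseries /series/= big_nat_recl//.
  rewrite [in X in _ = _ + m * X]big_nat_recl//.
  rewrite !expr0 !mulr1 size_familiesS0 natrM mulrDr [RHS]addrCA; congr +%R.
  rewrite !mulr_sumr -big_split/=; apply: eq_bigr => i _.
  rewrite size_familiesSS// natrD !natrM natrB ?expn_gt0 ?me// natrX -/m (exprS t) /q.
  by ring.
rewrite exprSr mulrA -[_ ^+ f * m]mulrC.
apply: (affine_recurrence_cvg q1 yS).
apply: cvgM; first exact: cvg_cst.
by rewrite (cvg_shiftS y).
Unshelve. all: by end_near.
Qed.

(** * The cells of the space of maps *)

Lemma card_fset_set_seq (T : choiceType) (s : seq T) :
  uniq s -> #|` fset_set [set` s]|%fset = size s.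
Proof.
move=> us; rewrite -[in RHS](undup_id us) -(card_fseq s); congr (#|` _|%fset).
rewrite -[RHS]set_fsetK; congr fset_set.
by apply/seteqP; split => x /=; rewrite inE.
Qed.

Lemma enum_card (T : choiceType) (P : set T) (m : nat) :
  (P #= `I_m)%card ->
  exists e : seq P, [/\ uniq e, size e = m & forall x, x \in e].
Proof.
move=> cP.
have fP : finite_set P by exists m.
exists (pmap insub (fset_set P : seq T)).
have mP x : x \in P -> (x \in fset_set P) by rewrite in_fset_set.
split.
- by apply: pmap_sub_uniq; exact: fset_uniq.
- rewrite size_pmap_sub -(card_fset_set cP) -[RHS](count_predT (fset_set P : seq T)).
  by apply: eq_in_count => x; rewrite /= in_fset_set//.
- by move=> x; rewrite mem_pmap_sub; apply: mP; exact: valP.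
Qed.

(** Assignments to the 0-cells are encoded by indices into the enumeration [e]
    of [P], and families of patterns by lists; by [map_cell_nonempty] and
    [map_cell_disjoint] distinct codes give distinct cells. *)
Lemma k_cells_seq (R : realType) (n d f0 f1 : nat)
    (P : set 'rV[R]_n) (Q : set 'rV[R]_d)
    (p : 'I_f0 -> 'rV[R]_d) (u v : 'I_f1 -> 'rV[R]_d) (e : seq P) (k : nat) :
  is_cell_decomposition Q p u v ->
  uniq e -> (forall x, x \in e) -> (0 < size e)%N ->
  exists s : seq (set (Q -> P)),
    [/\ uniq s, size s = (size e ^ f0 * size (families e f1 k))%N &
        k_cells P Q p u v k = [set` s]].
Proof.
move=> dec ue fe me.
have x0 : P by case: (e) me.
pose A (phi : {ffun 'I_f0 -> 'I_(size e)}) (i : 'I_f0) : P := nth x0 e (phi i).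
pose W (F : seq (pattern P)) (j : 'I_f1) : pattern P := nth (x0, [::]) F j.
exists [seq map_cell p u v (A phi) (W F) | phi <- enum {ffun 'I_f0 -> 'I_(size e)},
   F <- families e f1 k].
have admW F : F \in families e f1 k -> forall j, admissible (W F j).
  by move=> /(mem_families fe)[sF aF _] j; apply: aF; rewrite mem_nth// sF.
split.
- apply: allpairs_uniq; [exact: enum_uniq|exact: uniq_families|].
  move=> x y /allpairsP[[phi F] [/= _ Ffam ->]].
  move=> /allpairsP[[phi' F'] [/= _ Ffam' ->]] /= eqC {x y}.
  have [f fC] := map_cell_nonempty dec (A phi) (W F).
  have fC' : map_cell p u v (A phi') (W F') f by rewrite -eqC.
  have [eqA eqW] := map_cell_disjoint dec (admW _ Ffam) (admW _ Ffam') fC fC'.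
  have /(mem_families fe)[sF _ _] := Ffam.
  have /(mem_families fe)[sF' _ _] := Ffam'.
  congr pair.
    apply/ffunP => i; apply: val_inj; apply/eqP.
    rewrite -(nth_uniq x0 (ltn_ord _) (ltn_ord _) ue); apply/eqP.
    exact: (congr1 (fun h : 'I_f0 -> P => h i) eqA).
  apply: (@eq_from_nth _ (x0, [::])) => [|i]; first by rewrite sF sF'.
  by rewrite sF => ilt; exact: (congr1 (fun h => h (Ordinal ilt)) eqW).
- by rewrite size_allpairs -cardE card_ffun !card_ord.
apply/seteqP; split => [C [a [w [adm jk ->]]]|C].
  apply/allpairsP; exists ([ffun i => Ordinal (etrans (index_mem (a i) e) (fe (a i)))],
     [seq w j | j : 'I_f1]); split => /=.
  - by rewrite mem_enum.
  - apply/(mem_families fe); split.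
    + by rewrite size_map size_enum_ord.
    + by move=> _ /mapP[j _ ->].
    + by rewrite -map_comp sumnE big_map big_enum.
  congr map_cell; apply: funext => i.
    by rewrite /A ffunE /= nth_index.
  by rewrite /W (nth_map i) ?size_enum_ord// nth_ord_enum.
move=> /allpairsP[[phi F] [/= _ Ffam ->]].
exists (A phi), (W F); split => //; first exact: admW.
have /(mem_families fe)[sF _ <-] := Ffam.
by rewrite sumnE big_map (big_nth (x0, [::])) sF big_mkord.
Qed.

Theorem mainTheorem2 (R : realType) (n d m f0 f1 : nat)
    (P : set 'rV[R]_n) (Q : set 'rV[R]_d)
    (p : 'I_f0 -> 'rV[R]_d) (u v : 'I_f1 -> 'rV[R]_d)
    (hm : (1 <= m)%N) (hP : (P #= `I_m)%card)
    (hQ : polytope Q) (hQ1 : polyhedral_dim Q 1)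
    (hdec : is_cell_decomposition Q p u v) :
  [/\ euler_measure Q = f0%:Z - f1%:Z,
      forall k : nat, finite_set (k_cells P Q p u v k),
      \forall t \near (0 : R),
        pseries (fun k => (num_cells P Q p u v k)%:R) t @ \oo
          --> cell_gf m f0 f1 t,
      cell_gf m f0 f1 (-1 : R) = m%:R ^ (f0%:Z - f1%:Z) &
      m%:R ^ (f0%:Z - f1%:Z) = (euler_measure P)%:~R ^ (euler_measure Q) :> R].
Proof.
have m0 : m%:R != 0 :> R by rewrite pnatr_eq0 -lt0n.
have chiQ : euler_measure Q = f0%:Z - f1%:Z.
  by apply: (euler_measure_cells hdec); exact: hQ1.2.
have [e [ue se fe]] := enum_card hP.
have se0 : (0 < size e)%N by rewrite se.
have cells k := k_cells_seq k hdec ue fe se0.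
have chiP : euler_measure P = m%:Z.
  rewrite -[RHS]subr0.
  have fP : finite_set P by exists m.
  pose no (j : 'I_0) : 'rV[R]_n := 0.
  have x0 : P by case: (e) se0.
  apply: (@euler_measure_cells _ _ m 0 P (fun i : 'I_m => \val (nth x0 e i)) no no).
    split; first by case.
    split.
    - apply/seteqP; split => [x [[i|[]//] _ ->]|x Px]; first exact: set_valP.
      pose x' : P := exist _ x (mem_set Px).
      have ilt : (index x' e < m)%N by rewrite -se index_mem.
      by exists (inl (Ordinal ilt)); rewrite //= nth_index.
    - move=> [i|[]//] [j|[]//] _ _ [x [-> /val_inj/eqP]].
      by rewrite nth_uniq ?se// => /eqP ij; congr inl; exact: val_inj.
    - by move=> [i|[]//] _; exists (\val (nth x0 e i)).
  move=> k C Ck CP; rewrite leqNgt; apply/negP => k1.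
  by apply: (open_cell_infinite Ck (ltnW k1)); exact: sub_finite_set fP.
split=> //.
- by move=> k; have [s [_ _ ->]] := cells k; exact: finite_seq.
- have numE k : num_cells P Q p u v k = (m ^ f0 * size (families e f1 k))%N.
    have [s [us ss sE]] := cells k.
    by rewrite /num_cells sE card_fset_set_seq// ss se.
  have e0 : 0 < (m%:R ^+ 2)^-1 :> R by rewrite invr_gt0 exprn_even_gt0.
  near=> t.
  have t1 : `|(m%:R ^+ 2 - 1) * t| < 1 :> R.
    have tlt : `|t| < (m%:R ^+ 2)^-1 by near: t; exact: (@nbhs0_lt _ R^o).
    have m1 : 1 <= m%:R ^+ 2 :> R by rewrite exprn_ege1// ler1n.
    rewrite normrM ger0_norm ?subr_ge0//.
    have : `|t| * m%:R ^+ 2 < 1 by rewrite -ltr_pdivlMr ?mul1r// exprn_even_gt0.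
    by have := normr_ge0 t; nra.
  rewrite -se in t1 *.
  have gf := families_gf ue fe se0 t1.
  rewrite /cell_gf.
  rewrite (_ : pseries _ t = (fun N => (size e)%:R ^+ f0 *
      pseries (fun k => (size (families e f1 k))%:R) t N)); last first.
    apply/funext => N; rewrite /pseries /series/= mulr_sumr.
    by apply: eq_bigr => i _; rewrite numE se natrM natrX mulrA.
  by apply: cvgM; [exact: cvg_cst|exact: gf].
- rewrite /cell_gf mulrN1 opprK addrC subrK expfzDr// exprnP; congr (_ * _).
  rewrite expr2 invfM mulrA divff// mul1r exprVn.
  by rewrite -exprnN exprnP.
by rewrite chiP chiQ.
Unshelve. all: by end_near.
Qed.
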